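(* Let $P$ be a monic element of $\mathcal{G}$ and let $H = P X P^{-1}$. Let $\{p_k(t)\}_{k\ge 0}$ be the polynomial sequence associated with $P$. Then $$p_n(t)\, p_m(t) = \sum_{k=0}^{n+m} d(n,m,k)\, p_k(t), \qquad n,m \in \mathbb{N},$$ where $$d(n,m,k) = p_m(H)_{n,k}, \qquad n,m,k\in\mathbb{N}.$$
   Context: $\mathbb{N}$ denotes the non-negative integers. All matrices are infinite, with complex entries and rows and columns indexed by $\mathbb{N}$. $\mathcal{L}$ is the set of matrices $A=[a_{j,k}]$ for which there is an integer $m$ such that $a_{j,k}=0$ whenever $j-k<m$ (lower generalized Hessenberg matrices); it is closed under addition, scalar multiplication and matrix multiplication (all sums in products are finite). $\mathcal{G}$ is the group, under matrix multiplication, of the lower triangular matrices ($a_{j,k}=0$ for $j<k$) with $a_{k,k}\neq 0$ for all $k\ge 0$; its unit is the identity matrix $I$. An element of $\mathcal{G}$ is monic if all its entries on the main diagonal are equal to $1$. $X$ is the matrix with $X_{j,j+1}=1$ for $j\ge 0$ and all other entries zero. The polynomial sequence associated with $P\in\mathcal{G}$ is $p_k(t)=\sum_{j=0}^{k} P_{k,j}\,t^j$, $k\ge 0$ (the $k$-th row of $P$ contains the coefficients of $p_k$). For a polynomial $w(t)=\sum_i w_i t^i$ and a matrix $M\in\mathcal{L}$, $w(M)=\sum_i w_i M^i$ with $M^0=I$. *)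

(* Defs.v *)
From HB Require Import structures.
From mathcomp Require Import all_boot all_order all_algebra.
From mathcomp Require Import boolp classical_sets functions cardinality fsbigop reals.
From mathcomp Require Export complex.

Set Implicit Arguments.
Unset Strict Implicit.
Unset Printing Implicit Defensive.
Import Order.TTheory GRing.Theory Num.Theory.
Local Open Scope classical_set_scope.
Local Open Scope ring_scope.

Definition imatrix (C : Type) := nat -> nat -> C.

Definition imx1 (C : fieldType) : imatrix C := fun j k => (j == k)%:R.

Definition shiftX (C : fieldType) : imatrix C := fun j k => (k == j.+1)%:R.

Definition lhess (C : fieldType) : set (imatrix C) :=
  [set A | exists m : int, forall j k : nat, j%:Z - k%:Z < m -> A j k = 0].

(* Finitely supported sum: it is 0 by convention if infinitely many terms are
   nonzero, which does not happen when A is in lhess (see imxmulE). *)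
Definition imxmul (C : fieldType) (A B : imatrix C) : imatrix C :=
  fun j k => \sum_(i \in [set: nat]) A j i * B i k.

Fixpoint imxexp (C : fieldType) (M : imatrix C) (n : nat) : imatrix C :=
  if n is n'.+1 then imxmul M (imxexp M n') else imx1 C.

Definition imxhorner (C : fieldType) (w : {poly C}) (M : imatrix C) :
  imatrix C := fun j k => \sum_(i < size w) w`_i * imxexp M i j k.

Definition lowerG (C : fieldType) : set (imatrix C) :=
  [set A | (forall j k, (j < k)%N -> A j k = 0) /\ (forall k, A k k != 0)].

Definition monicG (C : fieldType) : set (imatrix C) :=
  [set A | lowerG A /\ forall k, A k k = 1].

(* Inverse in the group lowerG; the default value imx1 is only reached
   outside of lowerG. *)
Definition imxinv (C : fieldType) (P : imatrix C) : imatrix C :=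
  xget (imx1 C : nat -> nat -> C)
    [set Q | lowerG Q /\ imxmul P Q = imx1 C /\ imxmul Q P = imx1 C].

Definition poly_seq (C : fieldType) (P : imatrix C) (k : nat) : {poly C} :=
  \poly_(j < k.+1) P k j.

Lemma imxmulE (C : fieldType) (A B : imatrix C) (m : int) (j k N : nat) :
  (forall j' k' : nat, j'%:Z - k'%:Z < m -> A j' k' = 0) ->
  j%:Z - N%:Z < m ->
  imxmul A B j k = \sum_(i < N) A j i * B i k.
Proof.
move=> hA hN; rewrite (fsbig_ord _ N (fun i => A j i * B i k)) /=.
rewrite /imxmul [RHS](fsbig_widen `I_N [set: nat]) //= => i [_ /= /negP].
rewrite -leqNgt => Ni; rewrite hA ?mul0r //.
apply: le_lt_trans hN; by rewrite lerD2l lerN2 lez_nat.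
Qed.

(* Main.v *)
Require Import Defs.
From mathcomp Require Import all_boot all_order all_algebra reals complex.
From mathcomp Require Import zify boolp classical_sets.

(** Let infinite matrices act on sequences of vectors by
    [(A . q)_j = \sum_k A_{j,k} q_k].  Then [P . (t^k)_k = p],
    [X . (t^k)_k = (t^(k+1))_k] and [P^-1 . p = (t^k)_k], so [H . p = t p].
    By induction [H^i . p = t^i p], hence [w(H) . p = w p] for every
    polynomial [w]; the case [w = p_m] is the claim. *)

Set Implicit Arguments.
Unset Strict Implicit.
Unset Printing Implicit Defensive.
Import GRing.Theory.
Local Open Scope ring_scope.

Section BandedMatrices.
Variable C : fieldType.
Implicit Types (A B P Q : imatrix C) (V : lmodType C).

(** This is the condition of [lhess] with [m = - c]. Keeping [c] explicit gives a known index at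
    which every sum can be cut. *)
Definition banded (c : nat) A := forall j k, (j + c < k)%N -> A j k = 0.

Lemma imxmul_banded c A B N j k : banded c A -> (j + c < N)%N ->
  imxmul A B j k = \sum_(i < N) A j i * B i k.
Proof.
move=> hA hN; apply: (@imxmulE C A B (- c%:Z)); last by lia.
by move=> j' k' h; apply: hA; lia.
Qed.

(** The band [c] serves as the cut-off of the sum. The module [V] is arbitrary so that [q] can be a
    sequence of polynomials or, with [V = C^o], a column of a matrix. *)
Definition imxact c A V (q : nat -> V) (j : nat) : V :=
  \sum_(k < (j + c).+1) A j k *: q k.

Lemma imxactE c A V (q : nat -> V) N j : banded c A -> (j + c < N)%N ->
  \sum_(k < N) A j k *: q k = imxact c A q j.
Proof.
move=> hA hN; rewrite /imxact [RHS](big_ord_widen N (fun k => A j k *: q k)) //.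
rewrite [LHS](bigID (fun k : 'I_N => (k < (j + c).+1)%N)) /=.
rewrite [X in _ + X]big1 ?addr0 // => k hk.
by rewrite hA ?scale0r //; lia.
Qed.

Lemma eq_imxact c A V (q r : nat -> V) j : q =1 r ->
  imxact c A q j = imxact c A r j.
Proof. by move=> qr; apply: eq_bigr => k _; rewrite qr. Qed.

Lemma banded_mul c d A B : banded c A -> banded d B ->
  banded (c + d) (imxmul A B).
Proof.
move=> hA hB j k hjk; rewrite (imxmul_banded _ _ hA (ltnSn _)) big1 // => i _.
by rewrite hB ?mulr0 //; have := ltn_ord i; lia.
Qed.

Lemma imxact_mul c d A B V (q : nat -> V) j : banded c A -> banded d B ->
  imxact (c + d) (imxmul A B) q j = imxact c A (imxact d B q) j.
Proof.
move=> hA hB; rewrite {1}/imxact.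
under eq_bigr => k _ do
  rewrite (imxmul_banded B k hA (ltnSn _)) scaler_suml.
rewrite exchange_big /=; apply: eq_bigr => i _.
(* As [i <= j + c], row [i] of [B] vanishes beyond [j + (c + d)], so the inner sum can use the outer
   bound. *)
rewrite -(@imxactE d B V q (j + (c + d)).+1 i) //; last first.
  by have := ltn_ord i; lia.
by rewrite scaler_sumr; apply: eq_bigr => k _; rewrite scalerA.
Qed.

Lemma imxmul_act c A B j k : banded c A ->
  imxmul A B j k = imxact c A (fun i => B i k : C^o) j.
Proof. by move=> hA; rewrite (imxmul_banded B k hA (ltnSn _)). Qed.

(** Column by column, this is [imxact_mul] applied to the columns of [Q]. *)
Lemma imxmulA c d A B Q : banded c A -> banded d B ->
  imxmul (imxmul A B) Q = imxmul A (imxmul B Q).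
Proof.
move=> hA hB; apply/funext => j; apply/funext => k.
rewrite (imxmul_act _ _ _ (banded_mul hA hB)) imxact_mul // (imxmul_act _ _ _ hA).
by apply: (@eq_imxact _ _ C^o) => i; rewrite (imxmul_act _ _ _ hB).
Qed.

Lemma banded_imx1 : banded 0 (imx1 C).
Proof.
move=> j k; rewrite addn0 => hjk; rewrite /imx1.
by rewrite (ltn_eqF hjk).
Qed.

Lemma imxact1 V (q : nat -> V) j : imxact 0 (imx1 C) q j = q j.
Proof.
rewrite /imxact addn0 (bigD1 ord_max) //= /imx1 eqxx scale1r big1 ?addr0 //.
move=> k hk; case: eqVneq => [e|_]; last by rewrite scale0r.
by rewrite -val_eqE /= -e eqxx in hk.
Qed.

Lemma imxmul1l A : imxmul (imx1 C) A = A.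
Proof.
apply/funext => j; apply/funext => k.
by rewrite (imxmul_act _ _ _ banded_imx1) imxact1.
Qed.

Lemma imxmul1r c A : banded c A -> imxmul A (imx1 C) = A.
Proof.
move=> hA; apply/funext => j; apply/funext => k.
(* The cut-off must exceed both the band limit [j + c] and the index [k] of the surviving term. *)
have hN : (j + c < j + c + k.+1)%N by lia.
have hk : (k < j + c + k.+1)%N by lia.
rewrite (imxmul_banded _ _ hA hN) (bigD1 (Ordinal hk)) //= /imx1 eqxx mulr1.
rewrite big1 ?addr0 // => i; rewrite -val_eqE /= => /negbTE ->.
by rewrite mulr0.
Qed.

Lemma banded_exp A i : banded 1 A -> banded i (imxexp A i).
Proof.
move=> hA; elim: i => [|i IHi]; first exact: banded_imx1.
exact: (banded_mul hA IHi).
Qed.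

Lemma banded_shiftX : banded 1 (shiftX C).
Proof. by move=> j k; rewrite addn1 /shiftX => /gtn_eqF ->. Qed.

Lemma lowerG_banded P : lowerG P -> banded 0 P.
Proof. by case=> hP _ j k; rewrite addn0; apply: hP. Qed.

(* Row [j] of the left inverse is the last row of the inverse of the leading
   principal submatrix of [P] of size [j + 1]. *)
Lemma lowerG_left_inverse P : lowerG P ->
  exists2 Q, lowerG Q & imxmul Q P = imx1 C.
Proof.
move=> [hP dP].
pose M j : 'M[C]_j.+1 := \matrix_(i, k) P i k.
pose Q : imatrix C := fun j k =>
  if (k <= j)%N then invmx (M j) ord_max (inord k) else 0.
have Qlow j k : (j < k)%N -> Q j k = 0 by move=> h; rewrite /Q leqNgt h.
have Qb : banded 0 Q by move=> j k; rewrite addn0; apply: Qlow.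
have QP : imxmul Q P = imx1 C.
  apply/funext => j; apply/funext => k.
  rewrite (@imxmul_banded 0 Q P j.+1) ?addn0 // /imx1.
  have [hkj|hjk] := leqP k j; last first.
    rewrite big1 => [|i _]; first by rewrite (ltn_eqF hjk).
    by rewrite hP ?mulr0 // (leq_trans (ltn_ord i)).
  have uM : M j \in unitmx.
    rewrite unitmxE det_trig; last first.
      by apply/is_trig_mxP => a b ab; rewrite mxE hP.
    by rewrite unitfE; apply/prodf_neq0 => i _; rewrite mxE.
  (* The last row of [invmx (M j) *m M j = 1] is row [j] of the claim. *)
  have /matrixP/(_ ord_max (inord k)) := mulVmx uM.
  rewrite !mxE -val_eqE /= inordK // => <-.
  apply: eq_bigr => i _; rewrite mxE inordK // /Q -ltnS ltn_ord.
  by rewrite inord_val.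
exists Q => //; split=> // k; apply/eqP => Qk.
(* By triangularity the diagonal entry of the product is [Q k k * P k k], which must be 1. *)
have /(congr1 (fun A => A k k)) := QP.
rewrite (@imxmul_banded 0 Q P k.+1) ?addn0 // /imx1 eqxx big_ord_recr /=.
rewrite Qk mul0r addr0 big1 => [/esym/eqP|i _]; first by rewrite oner_eq0.
by rewrite hP ?mulr0.
Qed.

(** A left inverse [Q] of [P] has itself a left inverse [S], and [S = S (Q P) = (S Q) P = P]. Hence
    [Q] is two-sided and the default value of [xget] is not taken. *)
Lemma imxinvP P : lowerG P ->
  [/\ lowerG (imxinv P), imxmul P (imxinv P) = imx1 C
    & imxmul (imxinv P) P = imx1 C].
Proof.
move=> hP; rewrite /imxinv.
case: xgetP => [Q _ [hQ [PQ QP]] // | none]; exfalso.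
have [Q hQ QP] := lowerG_left_inverse hP.
have [S hS SQ] := lowerG_left_inverse hQ.
have [bP bQ bS] := And3 (lowerG_banded hP) (lowerG_banded hQ) (lowerG_banded hS).
have SP : S = P.
  by rewrite -[LHS](imxmul1r bS) -QP -(imxmulA _ bS bQ) SQ imxmul1l.
by apply: (none Q); split => //; split=> //; rewrite -{1}SP.
Qed.

Lemma imxact_monomials P k : imxact 0 P (fun i => 'X^i) k = poly_seq P k.
Proof. by rewrite /imxact addn0 /poly_seq poly_def. Qed.

Lemma imxact_shiftX V (q : nat -> V) j :
  imxact 1 (shiftX C) q j = q j.+1.
Proof.
rewrite /imxact addn1 (bigD1 ord_max) //= /shiftX eqxx scale1r big1 ?addr0 //.
by move=> k; rewrite -val_eqE /= => /negbTE ->; rewrite scale0r.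
Qed.

Lemma imxact_inv_poly_seq P k : lowerG P ->
  imxact 0 (imxinv P) (poly_seq P) k = 'X^k.
Proof.
move=> hP; have [hQ _ QP] := imxinvP hP.
transitivity (imxact 0 (imxinv P) (imxact 0 P (fun i => 'X^i)) k).
  by apply: eq_imxact => i; rewrite imxact_monomials.
rewrite -imxact_mul ?QP ?imxact1 //; exact: lowerG_banded.
Qed.

Lemma banded_conjX P : lowerG P ->
  banded 1 (imxmul (imxmul P (shiftX C)) (imxinv P)).
Proof.
move=> hP; have [/lowerG_banded bQ _ _] := imxinvP hP.
exact: (banded_mul (banded_mul (lowerG_banded hP) banded_shiftX) bQ).
Qed.

Lemma imxact_conjX P n : lowerG P ->
  imxact 1 (imxmul (imxmul P (shiftX C)) (imxinv P)) (poly_seq P) n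
  = 'X * poly_seq P n.
Proof.
move=> hP; have [/lowerG_banded bQ _ _] := imxinvP hP.
have bP := lowerG_banded hP.
(* The band 1 of the product is read as [1 + 0] here and as [0 + 1] below. *)
rewrite (@imxact_mul 1 0) //; last exact: (banded_mul bP banded_shiftX).
rewrite (@eq_imxact _ _ _ _ (fun i => 'X^i)); last first.
  by move=> i; rewrite imxact_inv_poly_seq.
rewrite (@imxact_mul 0 1) //; last exact: banded_shiftX.
rewrite (@eq_imxact _ _ _ _ (fun i => 'X * 'X^i)); last first.
  by move=> i; rewrite imxact_shiftX exprS.
rewrite -imxact_monomials /imxact mulr_sumr.
by apply: eq_bigr => i _; rewrite scalerAr.
Qed.

Section Eigensequence.
Variables (H : imatrix C) (p : nat -> {poly C}).
Hypotheses (bH : banded 1 H) (Hp : forall n, imxact 1 H p n = 'X * p n).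

(** The action has scalar coefficients, so the factor ['X^i] moves out of it and leaves [H] acting
    on [p]. *)
Lemma imxact_exp i n : imxact i (imxexp H i) p n = 'X^i * p n.
Proof.
elim: i n => [|i IHi] n; first by rewrite imxact1 expr0 mul1r.
rewrite /= (@imxact_mul 1 i) //; last exact: banded_exp.
rewrite (@eq_imxact _ _ _ _ (fun k => 'X^i * p k)) //.
rewrite exprSr -mulrA -Hp /imxact mulr_sumr.
by apply: eq_bigr => k _; rewrite scalerAr.
Qed.

(** Each power [i < size w] has band [i], and [n + i < N], so one bound [N] serves all powers of [H]
    at once. *)
Lemma imxhorner_act (w : {poly C}) n N : (n + size w <= N)%N ->
  \sum_(k < N) imxhorner w H n k *: p k = w * p n.
Proof.
move=> hN; rewrite /imxhorner.
under eq_bigr => k _ do rewrite scaler_suml.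
rewrite exchange_big /= -[in RHS](coefK w) poly_def mulr_suml.
apply: eq_bigr => i _; rewrite -scalerAl -imxact_exp.
rewrite -(@imxactE _ _ _ _ N n (banded_exp bH)) ?scaler_sumr; last first.
  by apply: leq_trans hN; rewrite ltn_add2l.
by apply: eq_bigr => k _; rewrite scalerA.
Qed.

End Eigensequence.
End BandedMatrices.

Theorem corollary3p1 (R : realType) (P : imatrix R[i]) (hP : monicG P) :
  let H := imxmul (imxmul P (shiftX R[i])) (imxinv P) in
  let p := poly_seq P in
  let d := fun n m k : nat => imxhorner (p m) H n k in
  forall n m : nat, p n * p m = \sum_(k < (n + m).+1) d n m k *: p k.
Proof.
move=> H p d n m; have [lP _] := hP.
(* The factor [p m] plays the role of [w]. Its size is at most [m.+1], which yields the upper limit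
   [n + m] of the sum. *)
rewrite mulrC (imxhorner_act (banded_conjX lP)) //.
- by move=> k; apply: imxact_conjX.
- by have : (size (p m) <= m.+1)%N := size_poly _ _; lia.
Qed.
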